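(* Let $a<b$ be real numbers, let $n\ge 0$ be an integer, and consider a family of polynomials $$p_t(z)=a_n(t)z^n+\cdots+a_1(t)z+a_0(t),\qquad t\in[a,b],$$ where $a_j:[a,b]\to\mathbb{C}$ is a continuous function for each $j=0,\ldots,n$. If $p_a(z)$ is a Hurwitz stable polynomial and $a_n(t)\neq 0$ for every $t\in[a,b)$, then either $p_t(z)$ is Hurwitz stable for every $t\in[a,b]$, or there exists $(t_*,\omega_* )\in(a,b]\times\mathbb{R}$ such that $p_{t_*}(i\omega_* )=0$.
   Context: A polynomial $p(z)$ with complex coefficients is called Hurwitz stable if all its roots lie in the open left half-plane $\{z\in\mathbb{C}:\operatorname{Re} z<0\}$. (In particular nonzero constants are Hurwitz stable, and the zero polynomial, for which every complex number is a root, is not.) In $p_{t_*}(i\omega_* )$, $i$ denotes the imaginary unit. The value $a_n(b)$ is allowed to be zero. *)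

(* Defs.v *)
From HB Require Import structures.
From mathcomp Require Import all_boot all_order all_algebra.
From mathcomp Require Import all_classical all_reals all_analysis.
From mathcomp Require Import complex.

Set Implicit Arguments.
Unset Strict Implicit.
Unset Printing Implicit Defensive.

Import Order.TTheory GRing.Theory Num.Theory.
Import numFieldNormedType.Exports.

Local Open Scope ring_scope.
Local Open Scope complex_scope.

(* Every [z] is a root of the zero polynomial, which is therefore not stable;
   nonzero constants have no root and are stable. *)
Definition hurwitz_stable (R : realType) (p : {poly R[i]}) : Prop :=
  forall z : R[i], root p z -> complex.Re z < 0.

(* The coefficients take values in [R[i]^o] rather than [R[i]] because it is
   this alias that carries the topology given by the complex modulus. *)
Definition polyfam (R : realType) (n : nat) (c : 'I_n.+1 -> R -> R[i]^o)
    (t : R) : {poly R[i]} :=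
  \sum_(j < n.+1) (c j t : R[i]) *: 'X^j.

(* Main.v *)
Require Import Defs.
From mathcomp Require Import all_boot all_order all_algebra.
From mathcomp Require Import all_classical all_reals all_analysis.
From mathcomp Require Import complex.
Import Order.TTheory GRing.Theory Num.Theory.
Import numFieldNormedType.Exports.
Local Open Scope classical_set_scope.
Local Open Scope ring_scope.
Local Open Scope complex_scope.

Set Implicit Arguments.
Unset Strict Implicit.

(** Write [p_t] for the member of the family at [t], and suppose that no [p_t]
    with [t] in ]a, b] vanishes on the imaginary axis.  The set of the [t] for
    which [p_t] is stable is then open to the right and closed under limits
    from the left, so it is all of [a, b]: the infimum [s] of the unstable
    parameters could be neither stable nor unstable.  Both properties follow
    from the factorization of a stable polynomial into linear factors [z - r]
    with [Re r < 0], with no appeal to the argument principle.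

    Limits from the left ([stable_left_limit]).  A point of the closed right
    half-plane is at least as far from [r] as its projection to the axis is.
    Taking the product over the roots, a stable [p] satisfies
      [|p (i y)| <= |p (x + i y)|] for every [x >= 0] ([axis_norm_le]).
    This inequality at two fixed points passes to the limit of the parameters.
    As [p_s] has no root on the axis, the left-hand side is positive at [s],
    hence so is the right-hand side.  The degree may drop at [s], which is how
    the end point [b] is covered even when the leading coefficient vanishes.

    Openness ([near_stable]).  On the closed right half-plane each factor
    [z - r] is bounded below by a multiple of [1 + |z|], so a stable [p] of
    degree exactly [n] satisfies
      [d * (1 + |z|) ^ n <= |p z|] there, with [d > 0] ([stable_growth]).
    A small change of the coefficients alters the value at [z] by at most a
    small multiple of [(1 + |z|) ^ n] ([near_polyfam]), uniformly in [z], and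
    so cannot create a root in that unbounded region. *)

Lemma norm_sub_axis_le (C : numClosedFieldType) (r z : C) :
  'Re r <= 0 -> 0 <= 'Re z -> `|'i * 'Im z - r| <= `|z - r|.
Proof.
move=> r_le0 z_ge0.
rewrite -(@ler_pXn2r _ 2) ?nnegrE ?normr_ge0 // !normC2_Re_Im.
have Riy : 'Re ('i * 'Im z) = 0 by rewrite ReMr ?Creal_Im // Re_i mul0r.
have Iiy : 'Im ('i * 'Im z) = 'Im z by rewrite ImMr ?Creal_Im // Im_i mul1r.
rewrite !raddfB/= Riy Iiy sub0r lerD2r ler_pXn2r ?nnegrE ?oppr_ge0 //.
  by rewrite ler_wpDl.
by rewrite subr_ge0 (le_trans r_le0).
Qed.

(** The inequality refers neither to the roots nor to the degree of [p], so it
    survives a pointwise limit of polynomials, even one that lowers the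
    degree. *)
Lemma axis_norm_le (C : numClosedFieldType) (p : {poly C}) (z : C) :
  (forall r, root p r -> 'Re r < 0) -> 0 <= 'Re z ->
  `|p.['i * 'Im z]| <= `|p.[z]|.
Proof.
have [rs ->] := closed_field_poly_normal p => stable z_ge0.
rewrite !hornerZ !normrM ler_wpM2l // !horner_prod !normr_prod.
have [lp0|lp0] := eqVneq (lead_coef p) 0.
  have := stable 0; rewrite lp0 scale0r root0 raddf0 => /(_ isT).
  by rewrite ltxx.
rewrite big_seq_cond [leRHS]big_seq_cond.
apply: ler_prod => r /[!andbT] r_rs; rewrite normr_ge0 !hornerXsubC/=.
apply: norm_sub_axis_le => //; apply/ltW/stable.
by rewrite rootZ // root_prod_XsubC.
Qed.

(** Near [r] the bound comes from [m <= |z - r|], where [m = - Re r] is the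
    distance from [r] to the half-plane; far away it comes from the triangle
    inequality [1 + |z| <= (1 + |r|) + |z - r|].  The constant
    [m / (1 + |r| + m)] combines the two. *)
Lemma linear_factor_growth (C : numClosedFieldType) (r : C) :
  'Re r < 0 ->
  exists2 d : C, 0 < d &
    forall z, 0 <= 'Re z -> d * (1 + `|z|) <= `|z - r|.
Proof.
move=> r_lt0; set m := - 'Re r; set K := 1 + `|r|.
have m_gt0 : 0 < m by rewrite oppr_gt0.
have K_gt0 : 0 < K by rewrite ltr_pwDl.
have Km_gt0 : 0 < K + m := addr_gt0 K_gt0 m_gt0.
exists (m / (K + m)) => [|z z_ge0]; first exact: divr_gt0.
rewrite mulrAC ler_pdivrMr // [leRHS]mulrDr.
have le_m : m <= `|z - r|.
  apply: (@le_trans _ _ `|'Re (z - r)|).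
    rewrite raddfB/= ger0_norm ?lerDr //.
    by rewrite subr_ge0 (le_trans (ltW r_lt0)).
  rewrite -(@ler_pXn2r _ 2) ?nnegrE ?normr_ge0 // [leRHS]normC2_Re_Im.
  by rewrite real_normK ?Creal_Re // lerDl real_exprn_even_ge0 ?Creal_Im.
have le_z : 1 + `|z| <= K + `|z - r|.
  by rewrite -addrA lerD2l -{1}(subrKC r z); exact: ler_normD.
apply: le_trans (_ : m * (K + `|z - r|) <= _); first by rewrite ler_wpM2l // ltW.
rewrite mulrDr [m * `|_|]mulrC lerD2r.
by rewrite ler_wpM2r // ltW.
Qed.

(** The exponent has to be the degree of [p]: this is where the leading
    coefficient must not vanish, since a perturbation that raises the degree
    can bring in a root of large modulus with positive real part. *)
Lemma stable_growth (C : numClosedFieldType) (p : {poly C}) (n : nat) :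
  size p = n.+1 -> (forall r, root p r -> 'Re r < 0) ->
  exists2 d : C, 0 < d &
    forall z, 0 <= 'Re z -> d * (1 + `|z|) ^+ n <= `|p.[z]|.
Proof.
have [rs defp] := closed_field_poly_normal p => size_p stable.
have lp0 : lead_coef p != 0 by rewrite lead_coef_eq0 -size_poly_eq0 size_p.
have szrs : size rs = n.
  by move: size_p; rewrite defp size_scale // size_prod_XsubC => -[].
have rs_lt0 r : r \in rs -> 'Re r < 0.
  by move=> r_rs; apply: stable; rewrite defp rootZ // root_prod_XsubC.
suff [d d_gt0 dP] : exists2 d : C, 0 < d & forall z, 0 <= 'Re z ->
    d * (1 + `|z|) ^+ size rs <= `|(\prod_(r <- rs) ('X - r%:P)).[z]|.
  exists (`|lead_coef p| * d) => [|z z_ge0]; first by rewrite mulr_gt0 ?normr_gt0.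
  rewrite [in leRHS]defp hornerZ normrM -mulrA ler_wpM2l // -szrs.
  exact: dP.
elim: rs rs_lt0 {defp szrs} => [|r rs IHrs] rs_lt0.
  by exists 1 => // z _; rewrite big_nil hornerC normr1 mulr1.
have [d d_gt0 dP] : exists2 d : C, 0 < d & forall z, 0 <= 'Re z ->
    d * (1 + `|z|) ^+ size rs <= `|(\prod_(r <- rs) ('X - r%:P)).[z]|.
  by apply: IHrs => s s_rs; apply: rs_lt0; rewrite in_cons s_rs orbT.
have [e e_gt0 eP] := linear_factor_growth (rs_lt0 r (mem_head _ _)).
exists (e * d) => [|z z_ge0]; first exact: mulr_gt0.
rewrite big_cons hornerM hornerXsubC normrM /= exprS mulrACA.
by rewrite ler_pM ?eP ?dP // mulr_ge0 ?ltW ?exprn_gt0 // ltr_pwDl.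
Qed.

Lemma norm_sum_powers_le (C : numDomainType) (n : nat) (u : 'I_n.+1 -> C)
    (e z : C) :
  (forall j, `|u j| <= e) ->
  `|\sum_(j < n.+1) u j * z ^+ j| <= e * n.+1%:R * (1 + `|z|) ^+ n.
Proof.
move=> u_le; have e_ge0 : 0 <= e := le_trans (normr_ge0 _) (u_le ord0).
apply: le_trans (ler_norm_sum _ _ _) _.
rewrite mulrAC mulr_natr -[X in _ *+ X]card_ord -sumr_const.
apply: ler_sum => j _; rewrite normrM normrX ler_pM ?exprn_ge0 //.
apply: (@le_trans _ _ ((1 + `|z|) ^+ j)).
  by rewrite lerXn2r ?nnegrE ?addr_ge0 // lerDr.
by rewrite ler_weXn2l ?lerDl // -ltnS.
Qed.

Lemma hurwitz_stableP (R : realType) (p : {poly R[i]}) :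
  hurwitz_stable p <-> forall z : R[i], root p z -> 'Re z < 0.
Proof.
by split=> p_stable z pz; have := p_stable z pz; rewrite -complexRe ltcR.
Qed.

Lemma horner_polyfam (R : realType) (n : nat) (c : 'I_n.+1 -> R -> R[i]^o)
    (t : R) (z : R[i]) :
  (polyfam c t).[z] = \sum_(j < n.+1) (c j t : R[i]) * z ^+ j.
Proof.
by rewrite horner_sum; apply: eq_bigr => j _; rewrite hornerZ hornerXn.
Qed.

Lemma size_polyfam (R : realType) (n : nat) (c : 'I_n.+1 -> R -> R[i]^o)
    (t : R) :
  c ord_max t != 0 -> size (polyfam c t) = n.+1.
Proof.
move=> lead_neq0.
have -> : polyfam c t = \poly_(j < n.+1) (c (inord j) t : R[i]).
  by rewrite poly_def; apply: eq_bigr => j _; rewrite inord_val.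
rewrite size_poly_eq //=.
by rewrite (_ : inord n = ord_max) //; apply/val_inj; rewrite /= inordK.
Qed.

(** The neighbourhood does not depend on [z]: the growth of the powers is
    absorbed by the weight [(1 + |z|) ^ n], the one of [stable_growth]. *)
Lemma near_polyfam (R : realType) (a b : R) (n : nat)
    (c : 'I_n.+1 -> R -> R[i]^o) (s : R) (e : R[i]) :
  (forall j : 'I_n.+1, {within `[a, b], continuous (c j)}) ->
  a <= s <= b -> 0 < e ->
  \forall t \near s, a <= t <= b -> forall z : R[i],
    `|(polyfam c s).[z] - (polyfam c t).[z]| <=
      e * n.+1%:R * (1 + `|z|) ^+ n.
Proof.
move=> c_cont sab e_gt0.
have cP (j : 'I_n.+1) : \forall t \near s, a <= t <= b -> `|c j s - c j t| < e.
  have /subspace_continuousP/(_ s) := @c_cont j.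
  rewrite /= in_itv/= => /(_ sab) /cvgrPdist_lt /(_ e e_gt0).
  rewrite near_withinE; apply: filterS => t tP tab.
  by apply: tP; rewrite /= in_itv.
have := filter_forall (nbhs_filter s) cP.
apply: filterS => t tP tab z.
rewrite !horner_polyfam -sumrB.
under eq_bigr do rewrite -mulrBl.
by apply: norm_sum_powers_le => j; apply/ltW/tP.
Qed.

Lemma near_horner_polyfam (R : realType) (a b : R) (n : nat)
    (c : 'I_n.+1 -> R -> R[i]^o) (s : R) (z e : R[i]) :
  (forall j : 'I_n.+1, {within `[a, b], continuous (c j)}) ->
  a <= s <= b -> 0 < e ->
  \forall t \near s, a <= t <= b ->
    `|(polyfam c s).[z] - (polyfam c t).[z]| <= e.
Proof.
move=> c_cont sab e_gt0; pose k := n.+1%:R * (1 + `|z|) ^+ n.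
have k_gt0 : 0 < k by rewrite mulr_gt0 ?ltr0n ?exprn_gt0 ?ltr_pwDl.
have := near_polyfam c_cont sab (divr_gt0 e_gt0 k_gt0).
apply: filterS => t + tab => /(_ tab z).
by rewrite -mulrA -/k divfK ?gt_eqF.
Qed.

Lemma near_stable (R : realType) (a b : R) (n : nat)
    (c : 'I_n.+1 -> R -> R[i]^o) (s : R) :
  (forall j : 'I_n.+1, {within `[a, b], continuous (c j)}) ->
  a <= s <= b -> c ord_max s != 0 ->
  hurwitz_stable (polyfam c s) ->
  \forall t \near s, a <= t <= b -> hurwitz_stable (polyfam c t).
Proof.
move=> c_cont sab /size_polyfam size_s /hurwitz_stableP /(stable_growth size_s).
case=> d d_gt0 dP.
have n_gt0 : 0 < n.+1%:R :> R[i] by rewrite ltr0n.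
(* Half of the growth constant: the perturbation stays below [|p_s z|]. *)
have e_gt0 : 0 < d / 2 / n.+1%:R by rewrite !divr_gt0.
have := near_polyfam c_cont sab e_gt0; apply: filterS => t tP tab.
apply/hurwitz_stableP => z /rootP pz0.
rewrite real_ltNge ?Creal_Re ?real0 //; apply/negP => z_ge0.
have := tP tab z; rewrite pz0 subr0 divfK ?gt_eqF // => /(le_trans (dP z z_ge0)).
rewrite ler_pM2r ?exprn_gt0 ?ltr_pwDl // ler_pdivlMr //.
by rewrite ger_pMr // lern1.
Qed.

Lemma stable_left_limit (R : realType) (a b : R) (n : nat)
    (c : 'I_n.+1 -> R -> R[i]^o) (s : R) :
  (forall j : 'I_n.+1, {within `[a, b], continuous (c j)}) ->
  a < s <= b ->
  (forall t, a <= t < s -> hurwitz_stable (polyfam c t)) ->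
  (forall w : R, (polyfam c s).['i%C * w%:C] != 0) ->
  hurwitz_stable (polyfam c s).
Proof.
move=> c_cont /andP[a_s s_b] stable axis_neq0.
have sab : a <= s <= b by rewrite ltW.
apply/hurwitz_stableP => z /rootP pz0.
rewrite real_ltNge ?Creal_Re ?real0 //; apply/negP => z_ge0.
(* The projection of the hypothetical root [z] to the imaginary axis. *)
pose iy : R[i] := 'i * 'Im z.
have D_gt0 : 0 < `|(polyfam c s).[iy]|.
  by rewrite normr_gt0 /iy -complexiE -complexIm axis_neq0.
set D := `|_| in D_gt0.
(* At a stable [t] close to [s], [D <= 2 D / 3] would follow from
   [|p_t iy| <= |p_t z|], since both values move by at most [D / 3]. *)
have e_gt0 : 0 < D / 3 by rewrite divr_gt0.
have [t [ta ts tz ty]] : exists t, [/\ a <= t, t < s,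
    `|(polyfam c s).[z] - (polyfam c t).[z]| <= D / 3 &
    `|(polyfam c s).[iy] - (polyfam c t).[iy]| <= D / 3].
  apply: (@filter_ex _ s^'-).
  near=> t.
  have ta : a <= t by near: t; exact: nbhs_left_ge.
  have ts : t < s by near: t; exact: nbhs_left_lt.
  have tab : a <= t <= b by rewrite ta (le_trans (ltW ts)).
  split=> //; move: tab; near: t; apply: cvg_within;
    exact: near_horner_polyfam c_cont sab e_gt0.
have tas : a <= t < s by rewrite ta.
have /hurwitz_stableP/axis_norm_le/(_ z_ge0) le_zy := stable t tas.
have : D <= D / 3 + D / 3.
  rewrite /D -{1}(subrK (polyfam c t).[iy] (polyfam c s).[iy]).
  apply: le_trans (ler_normD _ _) (lerD ty (le_trans le_zy _)).
  by move: tz; rewrite pz0 sub0r normrN.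
by rewrite -mulrDl ler_pdivlMr // -mulr2n -[leRHS]mulr_natr ler_pM2l // ler_nat.
Unshelve. all: by end_near.
Qed.

Unset Implicit Arguments.
Set Strict Implicit.

Theorem lemma2 (R : realType) (a b : R) (hab : a < b) (n : nat)
    (c : 'I_n.+1 -> R -> R[i]^o)
    (hc : forall j : 'I_n.+1, {within `[a, b], continuous (c j)})
    (hstable : hurwitz_stable (polyfam c a))
    (hlead : forall t : R, a <= t < b -> c ord_max t != 0) :
  (forall t : R, a <= t <= b -> hurwitz_stable (polyfam c t)) \/
  (exists t : R, exists w : R, a < t <= b /\ (polyfam c t).['i%C * w%:C] = 0).
Proof.
apply: contrapT => /not_orP [unstable axis].
pose V := [set t | a <= t <= b /\ ~ hurwitz_stable (polyfam c t)].
have [v [vab v_unstable]] : V !=set0.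
  by move/existsNP: unstable => [t /not_implyP[tab tP]]; exists t.
have V_lb : lbound V a by move=> t [/andP[]].
have V_inf : has_inf V by split; [exists v | exists a].
set s := inf V.
have a_s : a <= s by apply: lb_le_inf => //; exists v.
have s_le t : V t -> s <= t by apply: ge_inf; exists a.
have sv : s <= v by exact: s_le.
have vb : v <= b by case/andP: vab.
have s_stable : hurwitz_stable (polyfam c s).
  have [<- //|a_neq_s] := eqVneq a s.
  have a_lt_s : a < s by rewrite lt_neqAle a_neq_s.
  apply: (stable_left_limit hc); rewrite ?a_lt_s ?(le_trans sv) //.
    move=> t /andP[a_t t_s]; apply: contrapT => t_unstable.
    suff /s_le : V t by rewrite leNgt t_s.
    by split; rewrite // a_t (le_trans (ltW t_s)) ?(le_trans sv).
  move=> w; apply/eqP => w0; apply: axis; exists s, w.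
  by rewrite a_lt_s (le_trans sv).
have s_lt_b : s < b.
  apply: lt_le_trans vb; rewrite lt_neqAle sv andbT.
  by apply/eqP => sE; apply: v_unstable; rewrite -sE.
have sab : a <= s <= b by rewrite a_s ltW.
have lead_s : c ord_max s != 0 by rewrite hlead // a_s.
have /nbhs_ballP[e /= e_gt0 eP] := near_stable hc sab lead_s s_stable.
have [t Vt t_lt] := inf_adherent e_gt0 V_inf.
have [tab t_unstable] := Vt; apply: t_unstable; apply: (eP t _ tab).
by rewrite /ball/= ler0_norm ?subr_le0 ?s_le // opprB ltrBlDl.
Qed.
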